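(* Let $G$ be a compact Lie group, $D$ an irreducible unitary representation of $G$ of finite dimension $n$, and $G_K\subset G$ a finite subgroup of order $K$ such that the restriction of $D$ to $G_K$ is irreducible. Let $\psi:G\to\mathbb{C}$ be a function having components only in the representation $D$, i.e. of the form $$\psi(g)=\sum_{r,s=1}^n c_{rs}D_{rs}(g),\qquad g\in G,$$ with complex coefficients $c_{rs}$, where $D_{rs}$ are the matrix elements of $D$ in an orthonormal basis. Then $\psi$ is of positive type on $G$ if and only if its restriction to $G_K$ is of positive type on $G_K$.
   Context: A function $\psi$ on a group $G$ is of positive type if for every $k\in\mathbb{N}$ and every $k$-tuple $(h_1,\dots,h_k)$ of elements of $G$ the $k\times k$ matrix with entries $\psi(h_i^{-1}h_j)$ is positive semidefinite. *)

(* Defs.v *)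
From HB Require Import structures.
From mathcomp Require Import all_boot all_order all_algebra.
From mathcomp Require Import all_classical all_reals all_analysis.
From mathcomp Require Import complex.

Set Implicit Arguments.
Unset Strict Implicit.
Unset Printing Implicit Defensive.

Import Order.TTheory GRing.Theory Num.Theory.
Import numFieldNormedType.Exports.

Local Open Scope classical_set_scope.
Local Open Scope ring_scope.
Local Open Scope complex_scope.
Local Open Scope sesquilinear_scope.

(* [Ck_on k U f]: f is of class C^k on the open set U. Used between
   finite-dimensional spaces only, where it is enough to ask that all
   directional derivatives be of class C^(k-1). *)
Fixpoint Ck_on (R : realType) (V W : normedModType R) (k : nat)
    (U : set V) (f : V -> W) : Prop :=
  match k with
  | 0 => forall x, U x -> {for x, continuous f}
  | k'.+1 => (forall x, U x -> differentiable f x) /\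
             (forall v, Ck_on k' U ('D_v f))
  end.

Definition smooth_on (R : realType) (V W : normedModType R)
    (U : set V) (f : V -> W) : Prop :=
  open U /\ forall k, Ck_on k U f.

(* A homeomorphism from an open subset of T onto an open subset of R^d. Both
   directions are total functions whose values outside [chart_dom] and
   [chart_img] are irrelevant. *)
Record chart (R : realType) (d : nat) (T : topologicalType) := Chart {
  chart_dom : set T;
  chart_img : set 'rV[R]_d;
  chart_fun : T -> 'rV[R]_d;
  chart_inv : 'rV[R]_d -> T;
  chart_dom_open : open chart_dom;
  chart_img_open : open chart_img;
  chart_fun_img : forall x, chart_dom x -> chart_img (chart_fun x);
  chart_inv_dom : forall y, chart_img y -> chart_dom (chart_inv y);
  chart_funK : forall x, chart_dom x -> chart_inv (chart_fun x) = x;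
  chart_invK : forall y, chart_img y -> chart_fun (chart_inv y) = y;
  chart_fun_continuous :
    forall x, chart_dom x -> {for x, continuous chart_fun};
  chart_inv_continuous :
    forall y, chart_img y -> {for y, continuous chart_inv}
}.

HB.mixin Record Topological_isSmoothManifold (R : realType) (d : nat) T
    of Topological T := {
  manifold_hausdorff : hausdorff_space T;
  manifold_second_countable : @second_countable T;
  atlas : set (chart R d T);
  atlas_cover : forall x : T, exists2 c, atlas c & chart_dom c x;
  atlas_smooth : forall c1 c2, atlas c1 -> atlas c2 ->
    smooth_on
      [set y | chart_img c1 y /\ chart_dom c2 (chart_inv c1 y)]
      (fun y => chart_fun c2 (chart_inv c1 y))
}.

#[short(type="smoothManifoldType")]
HB.structure Definition SmoothManifold (R : realType) (d : nat) :=
  {T of Topological T & Topological_isSmoothManifold R d T}.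

(* Smoothness of the multiplication (on the product manifold) and of the
   inversion is read in charts. *)
HB.mixin Record SmoothManifold_isLieGroup (R : realType) (d : nat) G
    of SmoothManifold R d G & Group G := {
  lie_mul_continuous : continuous (fun p : G * G => (p.1 * p.2)%g);
  lie_inv_continuous : continuous (fun x : G => (x^-1)%g);
  lie_mul_smooth : forall c1 c2 c3 : chart R d G,
    atlas c1 -> atlas c2 -> atlas c3 ->
    smooth_on
      [set p : 'rV[R]_d * 'rV[R]_d |
        [/\ chart_img c1 p.1, chart_img c2 p.2 &
            chart_dom c3 (chart_inv c1 p.1 * chart_inv c2 p.2)%g]]
      (fun p => chart_fun c3 (chart_inv c1 p.1 * chart_inv c2 p.2)%g);
  lie_inv_smooth : forall c1 c2 : chart R d G, atlas c1 -> atlas c2 ->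
    smooth_on
      [set y | chart_img c1 y /\ chart_dom c2 ((chart_inv c1 y)^-1)%g]
      (fun y => chart_fun c2 ((chart_inv c1 y)^-1)%g)
}.

#[short(type="lieGroupType")]
HB.structure Definition LieGroup (R : realType) (d : nat) :=
  {G of SmoothManifold R d G & Group G & SmoothManifold_isLieGroup R d G}.

Section Representations.
Context (R : realType) (V : vectType R[i]).

Definition is_representation (G : groupType) (D : G -> 'End(V)) : Prop :=
  D 1%g = \1%VF /\ forall g h, D (g * h)%g = (D g \o D h)%VF.

Definition irreducible_rep (G : groupType) (D : G -> 'End(V)) : Prop :=
  {:V}%VS <> 0%VS /\
  forall W : {vspace V}, (forall g, (D g @: W <= W)%VS) ->
    W = 0%VS \/ W = {:V}%VS.

(* [dot] is linear in its first argument and conjugate-linear in the second.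
   V being finite-dimensional, continuity of D means continuity of all its
   matrix coefficients. *)
Definition unitary_rep (d : nat) (G : lieGroupType R d)
    (dot : {dot V for Num.conj}) (D : G -> 'End(V)) : Prop :=
  [/\ is_representation D,
      forall g u v, dot (D g u) (D g v) = dot u v &
      forall u v, continuous (fun g => dot (D g u) v : R[i]^o)].

(* The matrix element <e_r, D(g) e_s> in the basis e. *)
Definition matrix_element (G : groupType) (dot : {dot V for Num.conj})
    (n : nat) (e : n.-tuple V) (D : G -> 'End(V)) (r s : 'I_n) (g : G) : R[i] :=
  dot (D g (tnth e s)) (tnth e r).

End Representations.

Definition psdmx (R : realType) (k : nat) (A : 'M[R[i]]_k) : Prop :=
  A \is hermsymmx /\
  forall x : 'cV[R[i]]_k, 0 <= (x ^t Num.conj *m A *m x) 0 0.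

Definition positive_type (R : realType) (G : groupType) (psi : G -> R[i]) :
    Prop :=
  forall (k : nat) (h : 'I_k -> G),
    psdmx (\matrix_(i, j) psi ((h i)^-1 * h j)%g).

(* Main.v *)
(** Both positivity conditions are equivalent to positive semidefiniteness of the
    coefficient matrix c. Indeed the quadratic form of (psi (h_i^-1 h_j)) at x is
      sum_(r, s) c_rs <T e_s, T e_r>   with   T = sum_j x_j D(h_j),
    which is a sum of values of the quadratic form of c by Parseval's identity.
    Conversely, Schur orthogonality on the finite group writes every rank one
    operator as such a T, and rank one operators recover all values of the
    quadratic form of c. *)
Require Import Defs.
From HB Require Import structures.
From mathcomp Require Import all_boot all_order all_algebra.
From mathcomp Require Import all_classical all_reals all_analysis.
From mathcomp Require Import complex ring spectral.

Set Implicit Arguments.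
Unset Strict Implicit.
Unset Printing Implicit Defensive.

Import Order.TTheory GRing.Theory Num.Theory.
Import numFieldNormedType.Exports.

Local Open Scope classical_set_scope.
Local Open Scope ring_scope.
Local Open Scope sesquilinear_scope.

(** * Complex quadratic forms and Hermitian symmetry *)

Section QuadraticForms.
Variables (C : numClosedFieldType) (k : nat) (A : 'M[C]_k).

Lemma quad_formE (x y : 'cV[C]_k) :
  (x ^t Num.conj *m A *m y) 0 0 =
  \sum_i \sum_j (x i 0)^* * A i j * y j 0.
Proof.
rewrite mxE exchange_big; apply: eq_bigr => j _ /=.
by rewrite mxE mulr_suml; apply: eq_bigr => i _; rewrite !mxE.
Qed.

(** Polarization: reality of the form at [x + y] and at [x + 'i *: y] relates [b x y] to the
    conjugate of [b y x]; basis vectors then give the entries of [A]. *)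
Lemma quad_form_real_hermsym :
  (forall x : 'cV[C]_k, (x ^t Num.conj *m A *m x) 0 0 \is Num.real) ->
  A \is hermsymmx.
Proof.
pose b (x y : 'cV[C]_k) : C := (x ^t Num.conj *m A *m y) 0 0.
move=> realb.
have bDl x x' y : b (x + x') y = b x y + b x' y.
  by rewrite /b linearD /= map_mxD !mulmxDl mxE.
have bDr x y y' : b x (y + y') = b x y + b x y'.
  by rewrite /b mulmxDr mxE.
have bZl a x y : b (a *: x) y = a^* * b x y.
  by rewrite /b linearZ /= map_mxZ -!scalemxAl mxE.
have bZr a x y : b x (a *: y) = a * b x y.
  by rewrite /b -scalemxAr mxE.
have cross x y : b x y + b y x \is Num.real.
  have -> : b x y + b y x = b (x + y) (x + y) - b x x - b y y.
    by rewrite bDl !bDr; ring.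
  by rewrite !rpredB ?realb.
have herm x y : b x y = (b y x)^*.
  have /CrealP := cross x y; rewrite rmorphD /= => e1.
  (* The first use of [cross] controls the sum of [b x y] and [b y x]; replacing [y] by ['i *: y]
     controls their difference. *)
  have /CrealP := cross x ('i *: y).
  rewrite bZr bZl rmorphD !rmorphM /= conjCK conjCi => e2.
  have {}e2 : (b y x)^* - (b x y)^* = b x y - b y x.
    by apply: (mulfI (neq0Ci C)); rewrite !mulrBr -!mulNr -e2 addrC.
  have : (b x y) *+ 2 = (b y x)^* *+ 2.
    have -> : b x y *+ 2 = (b x y + b y x) + (b x y - b y x) by ring.
    by rewrite -e1 -e2; ring.
  by move/eqP; rewrite (eqrMn2r (R := C)) // => /eqP.
apply/is_hermitianmxP; rewrite expr0 scale1r; apply/matrixP => i j.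
have bE p q : b (delta_mx p 0) (delta_mx q 0) = A p q.
  rewrite /b quad_formE (bigD1 p) //= (bigD1 q) //= !mxE !eqxx conjC1 mul1r mulr1.
  rewrite big1 ?addr0 => [|s /negPf sq]; last by rewrite !mxE sq mulr0.
  rewrite big1 ?addr0 // => r /negPf rp; apply: big1 => s _.
  by rewrite !mxE rp conjC0 !mul0r.
by rewrite !mxE -!bE herm.
Qed.

End QuadraticForms.

Lemma psdmx_quad_form (R : realType) (k : nat) (A : 'M[R[i]]_k) :
  (forall x : 'cV[R[i]]_k, 0 <= (x ^t Num.conj *m A *m x) 0 0) -> psdmx A.
Proof.
move=> A0; split=> //; apply: quad_form_real_hermsym => x; exact: ger0_real.
Qed.

(** * Orthonormal expansions and Parseval's identity *)

Section OrthonormalBasis.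
Variables (C : numClosedFieldType) (V : vectType C) (dot : {dot V for Num.conj}).

Lemma dotC u v : dot u v = (dot v u)^*.
Proof. by rewrite hermC expr0 mul1r. Qed.

Variables (n : nat) (e : n.-tuple V).
Hypotheses (dimV : \dim {:V} = n) (e_on : orthonormal dot e).

Lemma dot_tnth r s : dot (tnth e r) (tnth e s) = (r == s)%:R.
Proof.
have [/tuple_uniqP ue oe] := orthonormalP e_on.
by rewrite oe ?mem_tnth // (inj_eq ue).
Qed.

Lemma orthonormal_basis_coord u : u = \sum_t dot u (tnth e t) *: tnth e t.
Proof.
have /andP[/eqP sp _] : basis_of {:V} e.
  by rewrite basisEfree (orthonormal_free e_on) subvf size_tuple dimV /=.
have /coord_span uE : u \in <<e>>%VS by rewrite sp memvf.
rewrite {1}uE; apply: eq_bigr => t _; rewrite -tnth_nth; congr (_ *: _).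
rewrite {2}uE linear_sumlz (bigD1 t) //= linearZl_LR /= -tnth_nth dot_tnth eqxx.
rewrite mulr1 big1 ?addr0 // => s /negPf st.
by rewrite linearZl_LR /= -tnth_nth dot_tnth st mulr0.
Qed.

Lemma parseval u v :
  dot u v = \sum_t dot u (tnth e t) * (dot v (tnth e t))^*.
Proof.
rewrite {1}(orthonormal_basis_coord u) linear_sumlz; apply: eq_bigr => t _.
by rewrite linearZl_LR /= [dot (tnth e t) v]dotC.
Qed.

End OrthonormalBasis.

(** * Rank one operators and Schur's lemma *)

Section RankOne.
Variables (C : numClosedFieldType) (V : vectType C) (dot : {dot V for Num.conj}).

Definition rank_one (u v x : V) : V := dot x v *: u.

Fact rank_one_is_linear u v : linear (rank_one u v).
Proof. by move=> a x y; rewrite /rank_one linearPl /= scalerDl scalerA. Qed.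

HB.instance Definition _ u v :=
  GRing.isLinear.Build C V V *:%R (rank_one u v) (rank_one_is_linear u v).

End RankOne.

(** In a basis [A] becomes a matrix of positive size, which has an eigenvalue because [C] is
    algebraically closed. *)
Lemma lfun_eigenvalue (C : numClosedFieldType) (V : vectType C) (A : 'End(V)) :
  {:V}%VS != 0%VS -> exists a, lker (A - a *: \1%VF) != 0%VS.
Proof.
rewrite -dimv_eq0 -lt0n => V0.
have bV := vbasisP {:V}%VS.
have [a Aa] := eigenvalue_closed (passmx.mxof (vbasis {:V}) (vbasis {:V}) A) V0.
by exists a; rewrite -[lker _]/(passmx.leigenspace A a) (passmx.leigenspaceE bV)
  passmx.vsof_eq0.
Qed.

Local Open Scope complex_scope.

(** An eigenspace of [A] is stable under every [D h] and nonzero, hence the whole space by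
    irreducibility. *)
Lemma schur (R : realType) (V : vectType R[i]) (H : groupType)
    (D : H -> 'End(V)) (A : 'End(V)) :
  irreducible_rep D -> (forall h, (A \o D h = D h \o A)%VF) ->
  exists a, A = a *: \1%VF.
Proof.
move=> [V0 irr] comm; have [a kerA] := lfun_eigenvalue A (introN eqP V0).
have kerE x : (A - a *: \1%VF)%VF x = A x - a *: x.
  by rewrite add_lfunE opp_lfunE scale_lfunE id_lfunE.
exists a; have [h|/eqP|kerT] := irr (lker (A - a *: \1%VF)).
- apply/subvP => _ /memv_imgP[x + ->]; rewrite !memv_ker !kerE.
  rewrite -comp_lfunE comm comp_lfunE -linearZ /= -linearB => /eqP ->.
  by rewrite linear0.
- by rewrite (negPf kerA).
apply/eqP; rewrite -subr_eq0; apply/eqP/lfunP => x; rewrite zero_lfunE.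
by apply/eqP; rewrite -memv_ker kerT memvf.
Qed.

(** Left translation by [g], read through the enumeration [f], permutes ['I_K]. This is the
    invariance behind averaging over the group. *)
Lemma sum_mulgl (H : groupType) (K : nat) (f : 'I_K -> H) (M : nmodType)
    (F : H -> M) (g : H) :
  bijective f -> \sum_i F (g * f i)%g = \sum_i F (f i).
Proof.
move=> [f' fK f'K]; rewrite [RHS](reindex (fun i => f' (g * f i)%g)).
  by apply: eq_bigr => i _; rewrite f'K.
by exists (fun i => f' (g^-1 * f i)%g) => i _; rewrite f'K ?mulKg ?mulVKg fK.
Qed.

(** * Schur orthogonality and positivity of the coefficient matrix *)

Section UnitaryRepresentations.
Variables (R : realType) (V : vectType R[i]) (dot : {dot V for Num.conj}).
Variables (n : nat) (e : n.-tuple V).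
Hypotheses (dimV : \dim {:V} = n) (e_on : orthonormal dot e).
Variables (H : groupType) (D : H -> 'End(V)).
Hypothesis D_rep : is_representation D.
Hypothesis D_unitary : forall h u v, dot (D h u) (D h v) = dot u v.

Lemma unitary_repV h u v : dot (D h^-1%g u) v = dot u (D h v).
Proof.
have [D1 DM] := D_rep.
by rewrite -(D_unitary h) -comp_lfunE -DM mulgV D1 id_lfunE.
Qed.

(* Schur orthogonality: the left-hand side is the sum over H of the
   conjugates of the rank one map x |-> <x, v> u, evaluated at w. *)
Lemma schur_orthogonality (K : nat) (f : 'I_K -> H) (u v w : V) :
  bijective f -> irreducible_rep D ->
  \sum_i dot w (D (f i) v) *: D (f i) u = (K%:R / n%:R * dot u v) *: w.
Proof.
move=> f_bij D_irr; have [D1 DM] := D_rep.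
pose A : 'End(V) :=
  \sum_i (D (f i) \o linfun (rank_one dot u v) \o D (f i)^-1%g)%VF.
have AE x : A x = \sum_i dot x (D (f i) v) *: D (f i) u.
  rewrite sum_lfunE; apply: eq_bigr => i _.
  by rewrite !comp_lfunE lfunE /= /rank_one linearZ /= unitary_repV.
have n0 : n%:R != 0 :> R[i].
  by rewrite pnatr_eq0 -dimV dimv_eq0; apply/eqP; case: D_irr.
(* Left translation permutes the conjugates summed in [A], so [A] commutes with [D] and is a
   scalar. *)
have [h|a Aa] := schur (A := A) D_irr.
  apply/lfunP => x; rewrite !comp_lfunE /= !AE linear_sum /=.
  rewrite -(sum_mulgl (fun g => dot (D h x) (D g v) *: D g u) h f_bij).
  by apply: eq_bigr => i _; rewrite linearZ /= !DM !comp_lfunE /= D_unitary.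
(* The scalar is found by computing the trace of [A] twice: each of the [K] conjugates has the trace
   [dot u v] of the rank one map. *)
have tr : a * n%:R = K%:R * dot u v.
  transitivity (\sum_t dot (A (tnth e t)) (tnth e t)).
    rewrite mulr_natr -[n in LHS]card_ord -sumr_const; apply: eq_bigr => t _.
    by rewrite Aa scale_lfunE id_lfunE linearZl_LR /= (dot_tnth e_on) eqxx mulr1.
  under eq_bigr do rewrite AE linear_sumlz.
  rewrite exchange_big /= mulr_natl -[K in RHS]card_ord -sumr_const.
  apply: eq_bigr => i _; rewrite -(D_unitary (f i) u v).
  rewrite (parseval dimV e_on); apply: eq_bigr => t _.
  by rewrite linearZl_LR /= mulrC -dotC.
rewrite -AE Aa scale_lfunE id_lfunE; congr (_ *: _).
by rewrite mulrAC -tr mulfK.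
Qed.

Variables (c : 'M[R[i]]_n) (psi : H -> R[i]).
Hypothesis psiE : forall h, psi h =
  \sum_(r < n) \sum_(s < n) c r s * matrix_element dot e D r s h.

(** By unitarity [D (h i)^-1] is the adjoint of [D (h i)], so the sum over [i] and [j] assembles
    into one copy of [T] in each argument of [dot]. *)
Lemma quad_form_lfun (k : nat) (h : 'I_k -> H) (x : 'cV[R[i]]_k) :
  let T : 'End(V) := \sum_j x j 0 *: D (h j) in
  (x ^t Num.conj *m (\matrix_(i, j) psi ((h i)^-1 * h j)%g) *m x) 0 0 =
  \sum_r \sum_s c r s * dot (T (tnth e s)) (T (tnth e r)).
Proof.
move=> T; have [_ DM] := D_rep.
have TE u : T u = \sum_j x j 0 *: D (h j) u.
  by rewrite sum_lfunE; apply: eq_bigr => j _; rewrite scale_lfunE.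
have dotT u v : dot (T u) (T v) =
    \sum_i \sum_j Num.conj (x i 0) * dot (D ((h i)^-1 * h j)%g u) v * x j 0.
  rewrite (TE v) linear_sumr; apply: eq_bigr => i _ /=.
  rewrite linearZr_LR /= TE linear_sumlz mulr_sumr; apply: eq_bigr => j _.
  by rewrite linearZl_LR /= DM comp_lfunE unitary_repV; ring.
under [RHS]eq_bigr => r _ do under eq_bigr => s _ do
  (rewrite dotT mulr_sumr; under eq_bigr => i _ do rewrite mulr_sumr).
rewrite quad_formE; symmetry.
under eq_bigr => r _ do rewrite exchange_big /=.
rewrite exchange_big /=; apply: eq_bigr => i _.
under eq_bigr => r _ do rewrite exchange_big /=.
rewrite exchange_big /=; apply: eq_bigr => j _.
rewrite mxE psiE mulr_sumr mulr_suml; apply: eq_bigr => r _.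
rewrite mulr_sumr mulr_suml; apply: eq_bigr => s _.
by rewrite /matrix_element; ring.
Qed.

Lemma psdmx_coef_positive_type : psdmx c -> positive_type psi.
Proof.
move=> [_ c_ge0] k h; apply: psdmx_quad_form => x; rewrite quad_form_lfun.
set T : 'End(V) := \sum_j _.
(* The [t]-th summand is the form of [c] at the [t]-th row of the matrix of [T]. *)
have -> : \sum_r \sum_s c r s * dot (T (tnth e s)) (T (tnth e r)) =
    \sum_t ((\col_s dot (T (tnth e s)) (tnth e t)) ^t Num.conj *m c *m
             (\col_s dot (T (tnth e s)) (tnth e t))) 0 0.
  under [RHS]eq_bigr do rewrite quad_formE.
  rewrite [RHS]exchange_big; apply: eq_bigr => r _ /=.
  rewrite [RHS]exchange_big; apply: eq_bigr => s _ /=.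
  rewrite (parseval dimV e_on) mulr_sumr; apply: eq_bigr => t _.
  by rewrite !mxE; ring.
by apply: sumr_ge0 => t _; apply: c_ge0.
Qed.

Lemma positive_type_psdmx_coef (K : nat) (f : 'I_K -> H) :
  bijective f -> irreducible_rep D -> positive_type psi -> psdmx c.
Proof.
move=> f_bij D_irr psi_pos; apply: psdmx_quad_form => y.
have n_gt0 : (0 < n)%N by rewrite lt0n -dimV dimv_eq0; apply/eqP; case: D_irr.
have K_gt0 : (0 < K)%N.
  by have [f' _ _] := f_bij; apply: leq_ltn_trans (ltn_ord (f' 1%g)).
have a_gt0 : 0 < K%:R / n%:R :> R[i] by rewrite divr_gt0 ?ltr0n.
set a := K%:R / n%:R in a_gt0.
(* Any unit vector would serve as [w], the direction of the image of the rank one operator. *)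
pose w := tnth e (Ordinal n_gt0).
have ww : dot w w = 1 by rewrite (dot_tnth e_on) eqxx.
(* The conjugates offset the conjugate-linearity of [dot] in its second argument: [dot (tnth e s) v]
   is [y s 0]. *)
pose v := \sum_s Num.conj (y s 0) *: tnth e s.
have [_] := psi_pos K f.
(* These are the weights of Schur orthogonality, so [T] is [a] times the rank one map sending [u] to
   [dot u v *: w]. *)
move=> /(_ (\col_i dot w (D (f i) v))); rewrite quad_form_lfun.
set T : 'End(V) := \sum_j _.
have TE s : T (tnth e s) = (a * y s 0) *: w.
  rewrite sum_lfunE; under eq_bigr => i _ do rewrite scale_lfunE mxE.
  rewrite schur_orthogonality //; congr (_ *: _); congr (_ * _).
  rewrite linear_sumr (bigD1 s) //= linearZr_LR /= conjCK (dot_tnth e_on) eqxx.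
  rewrite mulr1 big1 ?addr0 // => t /negPf ts.
  by rewrite linearZr_LR /= (dot_tnth e_on) eq_sym ts mulr0.
have -> : \sum_r \sum_s c r s * dot (T (tnth e s)) (T (tnth e r)) =
    a ^+ 2 * (y ^t Num.conj *m c *m y) 0 0.
  rewrite quad_formE mulr_sumr; apply: eq_bigr => r _.
  rewrite mulr_sumr; apply: eq_bigr => s _.
  have -> : dot (T (tnth e s)) (T (tnth e r)) = a * y s 0 * Num.conj (a * y r 0).
    by rewrite !TE linearZl_LR linearZr_LR /= ww mulr1.
  by rewrite rmorphM /= (CrealP (gtr0_real a_gt0)); ring.
by rewrite pmulr_rge0 // exprn_gt0.
Qed.

End UnitaryRepresentations.

(** * Enumeration of the finite subgroup and the equivalence *)

Lemma card_eq_bijective_ord (T : Type) (K : nat) :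
  ([set: T] #= `I_K)%card -> exists f : 'I_K -> T, bijective f.
Proof.
move=> /(fun cT => card_eq_trans cT card_II) /card_esym /card_bijP [f [g fK gK]].
exists (fun i => \val (f (to_setT i))); exists (fun x => \val (g (to_setT x))).
- by move=> i; rewrite (_ : to_setT _ = f (to_setT i)) ?fK //; apply: val_inj.
- by move=> x; rewrite (_ : to_setT _ = g (to_setT x)) ?gK //; apply: val_inj.
Qed.

Theorem mainTheorem3 (R : realType) (d : nat) (G : lieGroupType R d)
  (G_compact : compact [set: G])
  (n : nat) (V : vectType R[i]) (dimV : \dim {:V} = n)
  (dot : {dot V for Num.conj}) (D : G -> 'End(V))
  (D_unitary : unitary_rep dot D) (D_irr : irreducible_rep D)
  (S : {pred G}) (GK : subGroupType S) (K : nat)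
  (GK_order : ([set: GK] #= `I_K)%card)
  (DK_irr : irreducible_rep (fun g : GK => D (val g)))
  (e : n.-tuple V) (e_orthonormal : orthonormal dot e)
  (c : 'M[R[i]]_n) (psi : G -> R[i])
  (psiE : forall g, psi g =
     \sum_(r < n) \sum_(s < n) c r s * matrix_element dot e D r s g) :
  positive_type psi <-> positive_type (fun g : GK => psi (val g)).
Proof.
have [[D1 DM] D_inv _] := D_unitary.
have DK_rep : is_representation (fun g : GK => D (val g)).
  by split=> [|g h]; rewrite ?gmulf1 // gmulfM DM.
split=> [psi_pos k h | psi_pos].
  have := psi_pos k (fun i => val (h i)).
  by congr psdmx; apply/matrixP => i j; rewrite !mxE gmulfM gmulfV.
(* Positivity on [GK] makes [c] positive semidefinite; the same [c] expands [psi] on all of [G], so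
   positivity carries over to [G]. *)
have [f f_bij] := card_eq_bijective_ord GK_order.
apply: (psdmx_coef_positive_type dimV e_orthonormal (conj D1 DM) D_inv psiE).
exact: (positive_type_psdmx_coef dimV e_orthonormal DK_rep
  (fun g => D_inv (val g)) (fun g => psiE (val g)) f_bij DK_irr psi_pos).
Qed.
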